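(* Let $p$ be a prime, $f\ge 1$ and $q=p^f$. Let $m=\sum_{i=0}^{f-1}m_ip^i$ with $0 \leq m_i \leq p-1$. Let $r=\sum_{i=0}^{f-1}r_ip^i$ and $s=\sum_{i=0}^{f-1}s_ip^i$ with $r_i, s_i\geq (m_i+1)(q+1)-1$ for all $i$ and $r \equiv s \bmod (q-1)$. If $p \nmid \prod_{i=0}^{f-1}\binom{r_i}{m_i}$ and $p\nmid \prod_{i=0}^{f-1}\binom{s_i}{m_i}$, then $$\dfrac{V_r}{\langle \theta_0^{m_0+1}, \theta_1^{m_1+1}, \ldots, \theta_{f-1}^{m_{f-1}+1} \rangle} \simeq \dfrac{V_s}{\langle \theta_0^{m_0+1}, \theta_1^{m_1+1}, \ldots, \theta_{f-1}^{m_{f-1}+1} \rangle}$$ as representations of $\mathrm{GL}_2(\mathbb{F}_q)$ over $\mathbb{F}_q$.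
   Context: For $n\ge0$ and $0\le i\le f-1$, $V_{n}\circ\mathrm{Fr}^i$ is the space of homogeneous polynomials of degree $n$ over $\mathbb{F}_q$ in variables $X_i,Y_i$, with $\begin{pmatrix} a & b\\ c & d\end{pmatrix}\in\mathrm{GL}_2(\mathbb{F}_q)$ acting by $P(X_i,Y_i)\mapsto P(a^{p^i}X_i+c^{p^i}Y_i,\,b^{p^i}X_i+d^{p^i}Y_i)$. Set $V_r=\bigotimes_{i=0}^{f-1}(V_{r_i}\circ\mathrm{Fr}^i)$ and $V_s=\bigotimes_{i=0}^{f-1}(V_{s_i}\circ\mathrm{Fr}^i)$, viewed as spaces of multihomogeneous polynomials in $\mathbb{F}_q[X_0,Y_0,\dots,X_{f-1},Y_{f-1}]$; the integers $r_i$, $s_i$ are part of the data (they are not base-$p$ digits). The twisted Dickson polynomials are $\theta_i=X_iY_{i-1}^p-Y_iX_{i-1}^p$ for $0\le i\le f-1$, with the index convention $-1=f-1$. In each quotient, $\langle \theta_0^{m_0+1},\dots,\theta_{f-1}^{m_{f-1}+1}\rangle$ denotes the subspace of polynomials of $V_r$ (resp. $V_s$) lying in the ideal of $\mathbb{F}_q[X_0,Y_0,\dots,X_{f-1},Y_{f-1}]$ generated by these elements. *)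

(* Defs.v *)
From HB Require Import structures.
From mathcomp Require Import all_boot all_order all_algebra all_fingroup all_field.
From mathcomp Require Import generic_quotient ring_quotient.
From mathcomp Require Import ring mpoly boolp.

Set Implicit Arguments.
Unset Strict Implicit.
Unset Printing Implicit Defensive.

Import GRing.Theory.
Local Open Scope ring_scope.
Local Open Scope quotient_scope.

(** The carrier may be infinite-dimensional, as the polynomial ring is below. *)

Record rep (gT : finGroupType) (F : fieldType) := Rep {
  rep_space :> lmodType F;
  rep_act : gT -> {linear rep_space -> rep_space};
  rep_act1 : forall v, rep_act 1%g v = v;
  rep_actM : forall g h v, rep_act (g * h)%g v = rep_act g (rep_act h v) }.

Definition rep_iso (gT : finGroupType) (F : fieldType) (A B : rep gT F) : Prop :=
  exists2 phi : {linear A -> B},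
    bijective phi & forall g v, phi (rep_act A g v) = rep_act B g (phi v).

Record subrep (gT : finGroupType) (F : fieldType) (A : rep gT F) := Subrep {
  sub_pred :> {pred A};
  sub_submod : submod_closed sub_pred;
  sub_act : forall g v, v \in sub_pred -> rep_act A g v \in sub_pred }.

HB.instance Definition _ gT F (A : rep gT F) (S : subrep A) :=
  GRing.isSubmodClosed.Build F A (sub_pred S) (sub_submod S).

Section SubRep.
Variables (gT : finGroupType) (F : fieldType) (A : rep gT F) (S : subrep A).

Record sub_space := SubSpace { sub_val :> A; _ : sub_val \in sub_pred S }.

HB.instance Definition _ := [isSub for sub_val].
HB.instance Definition _ := [Choice of sub_space by <:].
HB.instance Definition _ := [SubChoice_isSubLmodule of sub_space by <:].

Definition sub_act_fun (g : gT) (v : sub_space) : sub_space :=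
  SubSpace (sub_act g (valP v)).

Lemma sub_act_linear g : linear (sub_act_fun g).
Proof. by move=> a u v; apply: val_inj; rewrite /= linearP. Qed.

HB.instance Definition _ g :=
  GRing.isLinear.Build F sub_space sub_space _ (sub_act_fun g) (sub_act_linear g).

Lemma sub_act1 v : sub_act_fun 1%g v = v.
Proof. by apply: val_inj; rewrite /= rep_act1. Qed.

Lemma sub_actM g h v :
  sub_act_fun (g * h)%g v = sub_act_fun g (sub_act_fun h v).
Proof. by apply: val_inj; rewrite /= rep_actM. Qed.

Definition sub_rep : rep gT F :=
  @Rep gT F sub_space (fun g => sub_act_fun g) sub_act1 sub_actM.

End SubRep.

Section QuotRep.
Variables (gT : finGroupType) (F : fieldType) (A : rep gT F) (S : subrep A).

Definition quot_space := Quotient.quot (sub_pred S).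
HB.instance Definition _ := GRing.Zmodule.on quot_space.

Local Notation pi := (\pi_(Quotient.quot (sub_pred S)) : A -> quot_space).

Lemma quot_piP (u v : A) : reflect (pi u = pi v) (u - v \in sub_pred S).
Proof. by rewrite Quotient.idealrBE; apply: eqP. Qed.

Lemma quot_piK (x : quot_space) : pi (repr x) = x.
Proof. exact: reprK. Qed.

Lemma quot_piD u v : pi (u + v) = pi u + pi v.
Proof. exact: (raddfD (\pi_(Quotient.quot (sub_pred S)))). Qed.

Definition quot_scale (a : F) (x : quot_space) : quot_space := pi (a *: repr x).

Lemma quot_scale_pi a u : quot_scale a (pi u) = pi (a *: u).
Proof.
apply/quot_piP; rewrite -scalerBr rpredZ //.
by apply/quot_piP; rewrite quot_piK.
Qed.

Lemma quot_scaleA a b x : quot_scale a (quot_scale b x) = quot_scale (a * b) x.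
Proof. by rewrite -[x]quot_piK !quot_scale_pi scalerA. Qed.

Lemma quot_scale1 : left_id 1 quot_scale.
Proof. by move=> x; rewrite -[x]quot_piK quot_scale_pi scale1r. Qed.

Lemma quot_scaleDr : right_distributive quot_scale +%R.
Proof.
move=> a x y; rewrite -[x]quot_piK -[y]quot_piK.
by rewrite -quot_piD !quot_scale_pi scalerDr quot_piD.
Qed.

Lemma quot_scaleDl x : {morph quot_scale^~ x : a b / a + b}.
Proof.
by move=> a b; rewrite -[x]quot_piK !quot_scale_pi scalerDl quot_piD.
Qed.

HB.instance Definition _ := GRing.Zmodule_isLmodule.Build F quot_space
  quot_scaleA quot_scale1 quot_scaleDr quot_scaleDl.

Lemma quot_piZ a u : pi (a *: u) = a *: pi u.
Proof. by rewrite -quot_scale_pi. Qed.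

Definition quot_act_fun (g : gT) (x : quot_space) : quot_space :=
  pi (rep_act A g (repr x)).

Lemma quot_act_pi g u : quot_act_fun g (pi u) = pi (rep_act A g u).
Proof.
apply/quot_piP; rewrite -linearB sub_act //.
by apply/quot_piP; rewrite quot_piK.
Qed.

Lemma quot_act_linear g : linear (quot_act_fun g).
Proof.
move=> a x y; rewrite -[x]quot_piK -[y]quot_piK.
by rewrite -quot_piZ -quot_piD !quot_act_pi linearP quot_piD quot_piZ.
Qed.

HB.instance Definition _ g := GRing.isLinear.Build F quot_space quot_space _
  (quot_act_fun g) (quot_act_linear g).

Lemma quot_act1 x : quot_act_fun 1%g x = x.
Proof. by rewrite -[x]quot_piK quot_act_pi rep_act1. Qed.

Lemma quot_actM g h x :
  quot_act_fun (g * h)%g x = quot_act_fun g (quot_act_fun h x).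
Proof. by rewrite -[x]quot_piK !quot_act_pi rep_actM. Qed.

Definition quot_rep : rep gT F :=
  @Rep gT F quot_space (fun g => quot_act_fun g) quot_act1 quot_actM.

End QuotRep.

(** The intersection of two subrepresentations, inside the first one. *)
Section SubCap.
Variables (gT : finGroupType) (F : fieldType) (A : rep gT F).
Variables (S T : subrep A).

Definition sub_cap_pred : {pred sub_rep S} :=
  [pred v : sub_space S | sub_val v \in sub_pred T].

Lemma sub_cap_submod : submod_closed sub_cap_pred.
Proof.
split=> [|a u v]; rewrite !inE /=; first exact: (rpred0 (sub_pred T)).
by move=> uT vT; apply: rpredD => //; apply: rpredZ.
Qed.

Lemma sub_cap_act g v :
  v \in sub_cap_pred -> rep_act (sub_rep S) g v \in sub_cap_pred.
Proof. by rewrite !inE /=; apply: sub_act. Qed.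

Definition sub_cap : subrep (sub_rep S) := Subrep sub_cap_submod sub_cap_act.

End SubCap.

(** The polynomial ring F_q[X_0, ..., X_(f-1), Y_0, ..., Y_(f-1)]: among the
    f + f variables, the first f are the X_i and the last f are the Y_i. *)

Section Polynomials.
Variables (F : finFieldType) (p f : nat).

Local Notation poly := {mpoly F[f + f]}.

Definition varX (i : 'I_f) : poly := 'X_(lshift f i).
Definition varY (i : 'I_f) : poly := 'X_(rshift f i).

(** X_i |-> a^(p^i) X_i + c^(p^i) Y_i and Y_i |-> b^(p^i) X_i + d^(p^i) Y_i *)
Definition gl_subst (g : {'GL_2[F]}) : (f + f).-tuple poly :=
  let A : 'M[F]_2 := GLval g in
  [tuple match split k with
         | inl i => (A 0 0 ^+ (p ^ i)) *: varX i + (A 1 0 ^+ (p ^ i)) *: varY i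
         | inr i => (A 0 1 ^+ (p ^ i)) *: varX i + (A 1 1 ^+ (p ^ i)) *: varY i
         end | k < f + f].

Definition gl_act (g : {'GL_2[F]}) : poly -> poly := comp_mpoly (gl_subst g).

HB.instance Definition _ g := GRing.Linear.copy (gl_act g) (gl_act g).
HB.instance Definition _ g := GRing.RMorphism.copy (gl_act g) (gl_act g).

(** [ord_pred] is the cyclic predecessor, so that the index -1 is f - 1. *)
Definition theta (i : 'I_f) : poly :=
  varX i * varY (ord_pred i) ^+ p - varY i * varX (ord_pred i) ^+ p.

Definition multihomog (r : 'I_f -> nat) : {pred poly} :=
  [pred P : poly | all (fun m : 'X_{1..f + f} =>
     [forall i : 'I_f, (m (lshift f i) + m (rshift f i))%N == r i]) (msupp P)].

Definition in_theta_ideal (m : 'I_f -> nat) : {pred poly} :=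
  [pred P : poly | `[< exists h : 'I_f -> poly,
     P = \sum_(i < f) h i * theta i ^+ (m i).+1 >]].

Lemma gl_actX g i : gl_act g (varX i) =
  (GLval g 0 0 ^+ (p ^ i)) *: varX i + (GLval g 1 0 ^+ (p ^ i)) *: varY i.
Proof.
rewrite /gl_act /varX comp_mpolyXU -tnth_nth tnth_mktuple.
by rewrite -[lshift f i]/(unsplit (inl i)) unsplitK.
Qed.

Lemma gl_actY g i : gl_act g (varY i) =
  (GLval g 0 1 ^+ (p ^ i)) *: varX i + (GLval g 1 1 ^+ (p ^ i)) *: varY i.
Proof.
rewrite /gl_act /varY comp_mpolyXU -tnth_nth tnth_mktuple.
by rewrite -[rshift f i]/(unsplit (inr i)) unsplitK.
Qed.

Lemma poly_ext (u v : {rmorphism poly -> poly}) :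
    (forall a, u a%:MP = v a%:MP) ->
    (forall i, u (varX i) = v (varX i)) -> (forall i, u (varY i) = v (varY i)) ->
  u =1 v.
Proof.
move=> uvC uvX uvY P; rewrite [P]mpolyE !rmorph_sum; apply: eq_bigr => m _.
rewrite -mul_mpolyC !rmorphM uvC; congr (_ * _).
rewrite mpolyXE_id !rmorph_prod; apply: eq_bigr => k _; rewrite !rmorphXn.
suff -> : u 'X_k = v 'X_k by [].
by case: (split_ordP k) => i ->; [apply: uvX | apply: uvY].
Qed.

Lemma gl_actC g a : gl_act g a%:MP = a%:MP.
Proof. exact: comp_mpolyC. Qed.

Hypotheses (p_prime : prime p) (cardF : #|F| = (p ^ f)%N).

Lemma pcharF : p \in [pchar F].
Proof. exact: card_finPcharP cardF p_prime. Qed.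

Lemma pchar_poly : p \in [pchar poly].
Proof. exact: (rmorph_pchar (@mpolyC (f + f) F) pcharF). Qed.

Lemma frobD (i : nat) (a b : F) :
  (a + b) ^+ (p ^ i) = a ^+ (p ^ i) + b ^+ (p ^ i).
Proof. by rewrite exprDn_pchar // pnatX pnatE // pcharF. Qed.

Lemma frobpD (P Q : poly) : (P + Q) ^+ p = P ^+ p + Q ^+ p.
Proof. by rewrite exprDn_pchar // pnatE // pchar_poly. Qed.

Lemma expn_pn0 i : (p ^ i == 0)%N = false.
Proof. by rewrite expn_eq0 (gtn_eqF (prime_gt0 p_prime)). Qed.

Lemma gl_act1 P : gl_act 1%g P = P.
Proof.
apply: (poly_ext (u := gl_act 1%g) (v := idfun)) => [a|i|i] /=.
- exact: gl_actC.
- by rewrite gl_actX GL_1E !mxE /= expr1n expr0n expn_pn0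
     scale1r scale0r addr0.
- by rewrite gl_actY GL_1E !mxE /= expr1n expr0n expn_pn0
     scale1r scale0r add0r.
Qed.

Lemma frob_mulmx i (g h : {'GL_2[F]}) k l :
  GLval (g * h)%g k l ^+ (p ^ i) =
  GLval g k 0 ^+ (p ^ i) * GLval h 0 l ^+ (p ^ i) +
  GLval g k 1 ^+ (p ^ i) * GLval h 1 l ^+ (p ^ i).
Proof.
rewrite GL_MxE mxE big_ord_recl big_ord1 frobD !exprMn.
by congr (_ + _ ^+ _ * _ ^+ _); congr (GLval _ _ _); apply: val_inj.
Qed.

Lemma gl_actM g h P : gl_act (g * h)%g P = gl_act g (gl_act h P).
Proof.
apply: (poly_ext (u := gl_act (g * h)%g) (v := gl_act g \o gl_act h))
  => [a|i|i] /=.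
- by rewrite !gl_actC.
- rewrite !gl_actX linearD !linearZ /= gl_actX gl_actY !frob_mulmx.
  by rewrite -!mul_mpolyC !(mpolyCD, mpolyCM); ring.
- rewrite !gl_actY linearD !linearZ /= gl_actX gl_actY !frob_mulmx.
  by rewrite -!mul_mpolyC !(mpolyCD, mpolyCM); ring.
Qed.

Lemma frob_pred (i : 'I_f) (a : F) : (a ^+ (p ^ ord_pred i)) ^+ p = a ^+ (p ^ i).
Proof.
rewrite -exprM -expnSr; case: i => [[|i] lti] /=.
  by rewrite add0n modn_small ?prednK // -cardF expf_card expr1.
by rewrite modnDr modn_small // ltnW.
Qed.

Lemma gl_act_theta g i : gl_act g (theta i) =
  (GLval g 0 0 ^+ (p ^ i) * GLval g 1 1 ^+ (p ^ i) -
   GLval g 1 0 ^+ (p ^ i) * GLval g 0 1 ^+ (p ^ i)) *: theta i.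
Proof.
rewrite /theta rmorphB !rmorphM !rmorphXn /= !gl_actX !gl_actY !frobpD.
rewrite !exprZn !frob_pred -!mul_mpolyC !(mpolyCB, mpolyCM).
move: (varX i) (varY i) (varX (ord_pred i) ^+ p) (varY (ord_pred i) ^+ p).
by move=> *; ring.
Qed.

Definition poly_rep : rep {'GL_2[F]} F :=
  @Rep _ F poly (fun g => gl_act g) gl_act1 gl_actM.

Lemma theta_ideal_submod m : submod_closed (in_theta_ideal m).
Proof.
split=> [|a P Q]; rewrite !inE.
  by apply/asboolP; exists (fun=> 0); rewrite big1 // => i _; rewrite mul0r.
move=> /asboolP[h ->] /asboolP[k ->]; apply/asboolP.
exists (fun i => a *: h i + k i); rewrite scaler_sumr -big_split /=.
by apply: eq_bigr => i _; rewrite mulrDl scalerAl.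
Qed.

Lemma theta_ideal_act m g P :
  P \in in_theta_ideal m -> rep_act poly_rep g P \in in_theta_ideal m.
Proof.
rewrite !inE => /asboolP[h ->]; apply/asboolP => /=.
pose c (i : 'I_f) := GLval g 0 0 ^+ (p ^ i) * GLval g 1 1 ^+ (p ^ i) -
   GLval g 1 0 ^+ (p ^ i) * GLval g 0 1 ^+ (p ^ i).
exists (fun i => c i ^+ (m i).+1 *: gl_act g (h i)).
rewrite rmorph_sum /=; apply: eq_bigr => i _.
by rewrite rmorphM rmorphXn /= gl_act_theta exprZn -scalerAl -scalerAr.
Qed.

Definition theta_ideal m : subrep poly_rep :=
  @Subrep _ F poly_rep (in_theta_ideal m)
    (theta_ideal_submod m) (@theta_ideal_act m).

Lemma multihomogP r (P : poly) :
  reflect (forall m, m \in msupp P ->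
             forall i, (m (lshift f i) + m (rshift f i) = r i)%N)
          (P \in multihomog r).
Proof.
by apply: (iffP allP) => rP m mP; [move=> i; apply/eqP/(forallP (rP m mP))
  | apply/forallP => i; apply/eqP/rP].
Qed.

Lemma multihomog_submod r : submod_closed (multihomog r).
Proof.
split=> [|a P Q]; first by apply/multihomogP => m; rewrite msupp0.
move=> /multihomogP rP /multihomogP rQ; apply/multihomogP => m.
by move/msuppD_le; rewrite mem_cat => /orP[/msuppZ_le/rP|/rQ].
Qed.

HB.instance Definition _ r :=
  GRing.isSubmodClosed.Build F poly (multihomog r) (multihomog_submod r).

Lemma multihomogM r s P Q : P \in multihomog r -> Q \in multihomog s ->
  P * Q \in multihomog (fun i => r i + s i)%N.
Proof.
move=> /multihomogP rP /multihomogP sQ; apply/multihomogP => m /msuppM_le.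
move=> /allpairsP[[m1 m2] /= [/rP m1r /sQ m2s ->]] i.
by rewrite !mnmDE addnACA m1r m2s.
Qed.

Lemma multihomog1 : 1 \in multihomog (fun=> 0%N).
Proof.
by apply/multihomogP => m; rewrite msupp1 inE => /eqP -> i; rewrite !mnmE.
Qed.

Lemma multihomog_exp r P n :
  P \in multihomog r -> P ^+ n \in multihomog (fun i => n * r i)%N.
Proof.
move=> rP; elim: n => [|n IHn]; first exact: multihomog1.
by rewrite exprS; apply: (multihomogM rP IHn).
Qed.

Lemma multihomog_prod (I : Type) (e : seq I) (r : I -> 'I_f -> nat) P :
    (forall k, P k \in multihomog (r k)) ->
  \prod_(k <- e) P k \in multihomog (fun i => \sum_(k <- e) r k i)%N.
Proof.
move=> rP; elim: e => [|k e IHe].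
  suff -> : (fun i : 'I_f => \sum_(k <- [::]) r k i)%N = fun=> 0%N.
    by rewrite big_nil multihomog1.
  by apply/funext => i; rewrite big_nil.
rewrite big_cons.
suff -> : (fun i => \sum_(k <- k :: e) r k i)%N =
          (fun i => r k i + \sum_(k <- e) r k i)%N by apply: multihomogM.
by apply/funext => i; rewrite big_cons.
Qed.

Lemma multihomog_var (j : 'I_f) :
  (varX j \in multihomog (fun i => (j == i) : nat)) /\
  (varY j \in multihomog (fun i => (j == i) : nat)).
Proof.
split; apply/multihomogP => m; rewrite msuppX inE => /eqP -> i;
  rewrite !mnm1E.
- by rewrite (inj_eq (@lshift_inj _ _)) eq_lrshift addn0.
- by rewrite (inj_eq (@rshift_inj _ _)) eq_rlshift add0n.
Qed.

Lemma multihomog_act r g P :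
  P \in multihomog r -> rep_act poly_rep g P \in multihomog r.
Proof.
move=> /multihomogP rP /=; rewrite /gl_act comp_mpolyEX big_seq.
apply: rpred_sum => m /rP rm; apply: rpredZ; rewrite comp_mpolyX.
rewrite big_split_ord /=.
have -> : r = fun i => (\sum_(j < f) m (lshift f j) * (j == i) +
                        \sum_(j < f) m (rshift f j) * (j == i))%N.
  apply/funext => i; rewrite -rm; congr (_ + _)%N.
    by rewrite (bigD1 i) //= eqxx muln1 big1 ?addn0 // => j /negPf ->;
       rewrite muln0.
  by rewrite (bigD1 i) //= eqxx muln1 big1 ?addn0 // => j /negPf ->;
       rewrite muln0.
apply: multihomogM; apply: multihomog_prod => j; apply: multihomog_exp;
  rewrite (tnth_nth 0) -comp_mpolyXU.
- rewrite -[comp_mpoly _ _]/(gl_act g (varX j)) gl_actX.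
  by apply: rpredD; apply: rpredZ; case: (multihomog_var j).
- rewrite -[comp_mpoly _ _]/(gl_act g (varY j)) gl_actY.
  by apply: rpredD; apply: rpredZ; case: (multihomog_var j).
Qed.

(** V_r as the space of multihomogeneous polynomials of multidegree r. *)
Definition V_sub r : subrep poly_rep :=
  @Subrep _ F poly_rep (multihomog r)
    (multihomog_submod r) (@multihomog_act r).

(** V_r / <theta_0^(m_0 + 1), ..., theta_(f-1)^(m_(f-1) + 1)> *)
Definition V_quot (m r : 'I_f -> nat) : rep {'GL_2[F]} F :=
  quot_rep (sub_cap (V_sub r) (theta_ideal m)).

End Polynomials.

(* Main.v *)
Require Import Defs.
From HB Require Import structures.
From mathcomp Require Import all_boot all_order all_algebra all_fingroup all_field.
From mathcomp Require Import generic_quotient ring_quotient.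
From mathcomp Require Import ring zify mpoly boolp.

Set Implicit Arguments.
Unset Strict Implicit.
Unset Printing Implicit Defensive.

Import GRing.Theory.

(** The common zeros of theta_0, ..., theta_(f-1) in (P^1)^f are the q + 1 points
    of P^1(F_q), embedded by x |-> (x, x^p, ..., x^(p^(f-1))).  Near the point
    Y_0 = ... = Y_(f-1) = 0 the element theta_i is -Y_i plus a p-th power of
    Y_(i-1); since m_i < p, the ideal <theta_i^(m_i+1)> is there contained in the
    monomial ideal <Y_i^(m_i+1)> ([theta_ideal_local]).  So a class in
    V_r / <theta^(m+1)> has, at every rational point, a jet: the coefficients of
    prod_i X_i^(r_i-k_i) Y_i^(k_i) for 0 <= k_i <= m_i.  Moving a point to the
    origin by a matrix g, the jets of P are the jets at the origin of the g.P.
    The theorem follows from two facts.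

    - The jets at the rational points identify V_r / <theta^(m+1)> with all
      families of jets.  Every family occurs ([jets_surjective]): the form
      X_i^q - X_i Y_i^(q-1) vanishes at all rational points but one, so its
      (m_i + 1)-st power isolates a single point.  The jets determine the class
      ([jets_injective]): taking (X_i Y_(i-1)^p)^(m_i+1) as the leading term of
      theta_i^(m_i+1), the monomials that cannot be rewritten span the quotient
      ([homog_spanned]), and they number at most (q + 1) prod_i (m_i + 1)
      ([card_irreducible_exp]), which is the number of coordinates of a family
      of jets.  A surjection between finite sets, onto one at least as large as
      its source, is injective.

    - The stabiliser B of the origin, the lower triangular matrices, acts on jets
      in a way that depends on sum_i r_i p^i only modulo q - 1, once the k-th
      coefficient of the jet is divided by prod_i C(r_i, k_i) ([njet_borel]).
      These binomials are nonzero in F_q because p does not divide prod_i C(r_i, m_i)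
      and k_i <= m_i < p.

    Hence 'P in V_r and Q in V_s have the same normalised jets at every g' is a
    G-invariant linear correspondence, total on both sides and matching the two
    ideals ([same_jets_exists]); it induces the isomorphism ([quot_rep_iso]). *)

(** * Isomorphisms of quotients from linear correspondences *)

Section QuotIso.
Local Open Scope ring_scope.
Local Open Scope quotient_scope.
Variables (gT : finGroupType) (F : fieldType) (A B : rep gT F).
Variables (S : subrep A) (T : subrep B) (R : A -> B -> Prop).

Hypothesis R_linear : forall a u u' v v',
  R u v -> R u' v' -> R (a *: u + u') (a *: v + v').
Hypothesis R_act : forall g u v, R u v -> R (rep_act A g u) (rep_act B g v).
Hypothesis R_left : forall u, exists v, R u v.
Hypothesis R_right : forall v, exists u, R u v.
Hypothesis R_sub : forall u v, R u v -> (u \in sub_pred S) = (v \in sub_pred T).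

Local Notation piS := (\pi_(Quotient.quot (sub_pred S)) : A -> quot_space S).
Local Notation piT := (\pi_(Quotient.quot (sub_pred T)) : B -> quot_space T).

Lemma R_pi u v u' v' : R u v -> R u' v' -> piS u = piS u' <-> piT v = piT v'.
Proof.
move=> uv uv'; have Rd : R (u - u') (v - v').
  by rewrite addrC (addrC v) -scaleN1r -(scaleN1r v'); apply: R_linear.
by split=> /quot_piP h; apply/quot_piP; [rewrite -(R_sub Rd) | rewrite (R_sub Rd)].
Qed.

(** A correspondence is easier to supply than a map: neither direction of the
    isomorphism has to be chosen linearly or equivariantly upstairs. *)
Lemma quot_rep_iso : rep_iso (quot_rep S) (quot_rep T).
Proof.
pose fw u := projT1 (cid (R_left u)); pose bw v := projT1 (cid (R_right v)).
have fwP u : R u (fw u) by rewrite /fw; case: cid.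
have bwP v : R (bw v) v by rewrite /bw; case: cid.
pose phi (x : quot_space S) : quot_space T := piT (fw (repr x)).
pose psi (y : quot_space T) : quot_space S := piS (bw (repr y)).
have phi_pi u v : R u v -> phi (piS u) = piT v.
  by move=> uv; apply/(R_pi (fwP _) uv); rewrite reprK.
have psi_pi u v : R u v -> psi (piT v) = piS u.
  by move=> uv; apply/(R_pi (bwP _) uv); rewrite reprK.
have phi_lin : linear phi.
  move=> a x y; rewrite -[x]quot_piK -[y]quot_piK -quot_piZ -quot_piD.
  rewrite (phi_pi _ _ (R_linear a (fwP (repr x)) (fwP (repr y)))).
  by rewrite quot_piD quot_piZ !(phi_pi _ _ (fwP _)).
pose phiL : {linear quot_rep S -> quot_rep T} :=
  HB.pack phi (GRing.isLinear.Build F _ _ _ phi phi_lin).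
exists phiL.
  exists psi => x /=.
    by rewrite -[x]quot_piK (phi_pi _ _ (fwP _)) (psi_pi _ _ (fwP _)).
  by rewrite -[x]quot_piK (psi_pi _ _ (bwP _)) (phi_pi _ _ (bwP _)).
move=> g x /=; rewrite -[x]quot_piK quot_act_pi.
by rewrite (phi_pi _ _ (R_act g (fwP _))) (phi_pi _ _ (fwP _)) quot_act_pi.
Qed.

End QuotIso.

(** * Boxes of exponents *)

Section Box.
Variable f : nat.
Implicit Types n : 'I_f -> nat.

Definition box n := {dffun forall i : 'I_f, 'I_(n i).+1}.
HB.instance Definition _ n := Finite.on (box n).

Definition box_val n (k : box n) : 'I_f -> nat := fun i => (k : {dffun _}) i.
Coercion box_val : box >-> Funclass.

Definition to_box n (mu : 'I_f -> nat) : box n :=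
  finfun (fun i => inord (mu i) : 'I_(n i).+1).

Lemma box_le n (k : box n) i : k i <= n i.
Proof. by rewrite -ltnS ltn_ord. Qed.

Lemma boxP n (k k' : box n) : (forall i, k i = k' i) -> k = k'.
Proof.
by move=> eq_k; apply/(@ffunP _ (fun i => 'I_(n i).+1)) => i; apply/val_inj/eq_k.
Qed.

Lemma to_boxE n mu i : mu i <= n i -> to_box n mu i = mu i.
Proof. by move=> le_mu; rewrite /box_val ffunE inordK. Qed.

Lemma card_box n : #|{: box n}| = \prod_(i < f) (n i).+1.
Proof.
rewrite (card_dep_ffun (fun i : 'I_f => 'I_(n i).+1)) foldrE big_image.
by apply: eq_bigr => i _; rewrite card_ord.
Qed.

End Box.

(** * Jets at the origin *)

Section Jets.
Local Open Scope ring_scope.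
Variables (F : finFieldType) (p f : nat).
Local Notation poly := {mpoly F[f + f]}.
Implicit Types (P Q : poly) (m r : 'I_f -> nat) (g b : {'GL_2[F]}).

(** Exponent of the monomial prod_i X_i^(n_i - k_i) Y_i^(k_i) of multidegree n;
    this reading needs k <= n, because of the truncated subtraction. *)
Definition mexp (n k : 'I_f -> nat) : 'X_{1..f + f} :=
  [multinom match split x with inl i => (n i - k i)%N | inr i => k i end
  | x < f + f].

Lemma mexpX n k i : mexp n k (lshift f i) = (n i - k i)%N.
Proof. by rewrite mnmE -[lshift f i]/(unsplit (inl i)) unsplitK. Qed.

Lemma mexpY n k i : mexp n k (rshift f i) = k i.
Proof. by rewrite mnmE -[rshift f i]/(unsplit (inr i)) unsplitK. Qed.

Lemma mnm_split (mu nu : 'X_{1..f + f}) :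
    (forall i, mu (lshift f i) = nu (lshift f i)) ->
    (forall i, mu (rshift f i) = nu (rshift f i)) ->
  mu = nu.
Proof. by move=> eX eY; apply/mnmP => x; case: (split_ordP x) => i ->. Qed.

(** The monomial ideal generated by the Y_i^(m_i + 1); congruence modulo it is
    equality of the jets at the origin. *)
Definition local_ideal m : {pred poly} :=
  [pred P : poly | all (fun mu : 'X_{1..f + f} =>
     [exists i : 'I_f, (m i < mu (rshift f i))%N]) (msupp P)].

Lemma local_idealP m P :
  reflect (forall mu : 'X_{1..f + f},
             (forall i, mu (rshift f i) <= m i)%N -> P@_mu = 0)
          (P \in local_ideal m).
Proof.
apply: (iffP allP) => [LP mu mu_le | LP mu].
  apply/eqP; rewrite mcoeff_eq0; apply/negP => /LP /existsP[i].
  by rewrite ltnNge mu_le.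
rewrite mcoeff_msupp; apply: contraNT; rewrite negb_exists => /forallP mu_le.
by apply/eqP/LP => i; rewrite leqNgt.
Qed.

Lemma local_ideal_submod m : submod_closed (local_ideal m).
Proof.
split=> [|a P Q].
  by apply/local_idealP => mu _; rewrite mcoeff0.
move=> /local_idealP LP /local_idealP LQ; apply/local_idealP => mu mu_le.
by rewrite mcoeffD mcoeffZ LP // LQ // mulr0 addr0.
Qed.

HB.instance Definition _ m :=
  GRing.isSubmodClosed.Build F poly (local_ideal m) (local_ideal_submod m).

Lemma local_idealM m P Q : P \in local_ideal m -> Q * P \in local_ideal m.
Proof.
move=> /local_idealP LP; apply/local_idealP => mu mu_le.
rewrite mcoeffM big1 // => -[a c] /= /eqP/mnmP mu_ac.
rewrite [P@_ _]LP ?mulr0 // => i; apply: leq_trans (mu_le i).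
by rewrite mu_ac mnmDE leq_addl.
Qed.

Lemma local_ideal_varY m i (n : nat) : (m i < n)%N -> varY F i ^+ n \in local_ideal m.
Proof.
move=> lt_mn; apply/local_idealP => mu /(_ i) mu_le.
rewrite /varY mcoeffXn; case: eqP => // mu_eq.
by move: mu_le; rewrite -mu_eq mulmnE mnm1E eqxx mul1n leqNgt lt_mn.
Qed.

Lemma gl_act_mon g (mu : 'X_{1..f + f}) :
  gl_act p g 'X_[mu] = (\prod_(i < f) gl_act p g (varX F i) ^+ mu (lshift f i)) *
                       (\prod_(i < f) gl_act p g (varY F i) ^+ mu (rshift f i)).
Proof.
rewrite mpolyXE_id rmorph_prod /= big_split_ord /=.
by congr (_ * _); apply: eq_bigr => i _; rewrite rmorphXn.
Qed.

(** A lower triangular matrix fixes the origin: it scales each Y_i. *)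
Lemma local_ideal_act m b P : GLval b 0 1 = 0 :> F ->
  prime p -> P \in local_ideal m -> gl_act p b P \in local_ideal m.
Proof.
move=> b01 p_prime /allP LP; rewrite [P]mpolyE linear_sum /= big_seq.
apply: rpred_sum => mu /LP /existsP[i m_lt]; rewrite linearZ /=.
apply: rpredZ; rewrite gl_act_mon; apply: local_idealM.
rewrite (bigD1 i) //= mulrC; apply: local_idealM.
rewrite gl_actY b01 expr0n expn_eq0 (gtn_eqF (prime_gt0 p_prime)) /=.
by rewrite scale0r add0r exprZn; apply: rpredZ; apply: local_ideal_varY.
Qed.

(** A multihomogeneous polynomial agrees with its jet modulo the local ideal, as
    the multidegree determines the X-exponents from the Y-exponents. *)
Lemma jet_expansion m r P : (forall i, m i <= r i)%N -> P \in multihomog r ->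
  P - \sum_(k : box m) P@_(mexp r k) *: 'X_[mexp r k] \in local_ideal m.
Proof.
move=> le_mr /multihomogP rP; apply/local_idealP => mu mu_le.
pose k := to_box m (fun i => mu (rshift f i)).
have kE i : k i = mu (rshift f i) by rewrite to_boxE.
have other (k' : box m) : k' != k -> mexp r k' != mu.
  by apply: contraNneq => eq_mu; apply/eqP/boxP => i; rewrite kE -eq_mu mexpY.
rewrite mcoeffB raddf_sum /= (bigD1 k) //= [X in _ - (_ + X)]big1 ?addr0; last first.
  by move=> k' /other /negPf neq; rewrite mcoeffZ mcoeffX neq mulr0.
rewrite mcoeffZ mcoeffX.
case: (mu =P mexp r k) => [<-|neq].
  by rewrite eqxx mulr1 subrr.
have -> : P@_mu = 0.
  apply/eqP; rewrite mcoeff_eq0; apply/negP => /rP mu_r; apply: neq.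
  apply: mnm_split => i; rewrite ?mexpX ?mexpY kE //.
  by rewrite -(mu_r i) addnK.
by case: eqP => [/esym //|_]; rewrite mulr0 subr0.
Qed.

Lemma mcoeff_prod_bihom (n : 'I_f -> nat) N (c : 'I_f -> 'I_N -> F)
    (j : {ffun 'I_f -> 'I_N}) :
  (\prod_(i < f) \sum_(l < N)
      c i l *: (varX F i ^+ (n i - l) * varY F i ^+ l))@_(mexp n (fun i => j i))
    = \prod_(i < f) c i (j i).
Proof.
have mono (h : {ffun 'I_f -> 'I_N}) :
    \prod_i (c i (h i) *: (varX F i ^+ (n i - h i) * varY F i ^+ h i))
    = (\prod_i c i (h i)) *: 'X_[mexp n (fun i => h i)].
  rewrite scaler_prod; congr (_ *: _); rewrite big_split /=.
  rewrite mpolyXE_id big_split_ord /=.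
  by congr (_ * _); apply: eq_bigr => i _; rewrite ?mexpX ?mexpY.
rewrite bigA_distr_bigA raddf_sum /= (bigD1 j) //= mono mcoeffZ mcoeffX eqxx.
rewrite mulr1 [X in _ + X]big1 ?addr0 // => h neq_hj; rewrite mono mcoeffZ mcoeffX.
case: eqP => [eq_h|_]; last by rewrite mulr0.
case/eqP: neq_hj; apply/ffunP => i; apply: val_inj => /=.
by rewrite -(mexpY n (fun i => h i)) eq_h mexpY.
Qed.

(** The coefficient of x^(n-l) y^l in (a x + c y)^(n-k) (d y)^k. *)
Definition bcoef (a c d : F) (n k l : nat) : F :=
  if (k <= l)%N then 'C(n - k, l - k)%:R * a ^+ (n - l) * c ^+ (l - k) * d ^+ k
  else 0.

(** The bound N is left free so that the forms attached to the different i can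
    be expanded over one index type. *)
Lemma binary_form_subst (x y : poly) (a c d : F) (n k N : nat) :
    (k <= n)%N -> (n < N)%N ->
  (a *: x + c *: y) ^+ (n - k) * (d *: y) ^+ k =
  \sum_(l < N) bcoef a c d n k l *: (x ^+ (n - l) * y ^+ l).
Proof.
move=> le_kn lt_nN.
rewrite -(big_mkord xpredT (fun l => bcoef a c d n k l *: (x ^+ (n - l) * y ^+ l))).
rewrite (@big_cat_nat _ _ _ k) //=; last by rewrite ltnW // (leq_ltn_trans le_kn).
rewrite big_nat_cond big1 ?add0r; last first.
  by move=> l; rewrite andbT /bcoef => /ltn_geF ->; rewrite scale0r.
rewrite (@big_cat_nat _ _ _ n.+1) //=; last by rewrite leqW.
rewrite [X in _ = _ + X]big_nat_cond [X in _ = _ + X]big1 ?addr0; last first.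
  move=> l /andP[/andP[lt_nl _] _]; rewrite /bcoef.
  by rewrite bin_small ?ltn_sub2r ?(leq_ltn_trans le_kn) // !mul0r if_same scale0r.
rewrite -{3}[k]add0n big_addn subSn // big_mkord exprDn mulr_suml.
apply: eq_bigr => i _; rewrite /bcoef leq_addl addnK !exprZn.
rewrite -subnDA addnC -mul_mpolyC -[_ *+ _]mulr_natl -!mul_mpolyC exprD.
rewrite !mpolyCM -mpolyC_nat.
by move: ((x ^+ _)) (y ^+ i) (y ^+ k) => *; ring.
Qed.

Lemma mcoeff_borel b r (k j : 'I_f -> nat) : prime p ->
    GLval b 0 1 = 0 :> F -> (forall i, k i <= r i)%N -> (forall i, j i <= r i)%N ->
  (gl_act p b 'X_[mexp r k])@_(mexp r j) =
  \prod_(i < f) bcoef (GLval b 0 0 ^+ (p ^ i)) (GLval b 1 0 ^+ (p ^ i))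
                      (GLval b 1 1 ^+ (p ^ i)) (r i) (k i) (j i).
Proof.
move=> p_prime b01 le_kr le_jr; rewrite gl_act_mon -big_split /=.
pose N := (\max_(i < f) r i).+1.
have ltN i : (r i < N)%N by rewrite ltnS (leq_bigmax i).
under eq_bigr => i _.
  rewrite mexpX mexpY gl_actX gl_actY b01 expr0n expn_eq0.
  rewrite (gtn_eqF (prime_gt0 p_prime)) /= scale0r add0r.
  rewrite (binary_form_subst _ _ _ _ _ (le_kr i) (ltN i)).
  over.
pose jN := [ffun i => Ordinal (leq_ltn_trans (le_jr i) (ltN i))].
have -> : mexp r j = mexp r (fun i => jN i).
  by apply: mnm_split => i; rewrite ?mexpX ?mexpY ffunE.
by rewrite mcoeff_prod_bihom; apply: eq_bigr => i _; rewrite ffunE.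
Qed.

End Jets.

(** * Binomial coefficients modulo p *)

(** Both sides count chains K in L in a set of n elements, with #K = k, #L = l. *)
Lemma mul_bin_trinomial n k l : k <= l <= n ->
  'C(n - k, l - k) * 'C(n, k) = 'C(n, l) * 'C(l, k).
Proof.
move=> /andP[le_kl le_ln]; have le_kn := leq_trans le_kl le_ln.
apply/eqP; rewrite -(@eqn_pmul2r (k`! * (l - k)`! * (n - l)`!)) ?muln_gt0 ?fact_gt0 //.
have e1 := bin_fact le_kn; have e2 := bin_fact le_ln; have e3 := bin_fact le_kl.
have e4 := bin_fact (leq_sub2r k le_ln).
have e5 : n - k - (l - k) = n - l by lia.
rewrite e5 in e4; apply/eqP.
by transitivity n`!; [rewrite -e1 -e4 | rewrite -e2 -e3]; ring.
Qed.

Section Binomials.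
Variable p : nat.
Hypothesis p_prime : prime p.

Lemma prime_dvd_fact m : p %| m`! -> p <= m.
Proof.
elim: m => [|m IHm]; first by rewrite fact0 Euclid_dvd1.
rewrite factS Euclid_dvdM // => /orP[/dvdn_leq -> //|/IHm].
exact: leqW.
Qed.

Lemma prime_ndvd_bin_le n m k :
  k <= m -> m <= n -> m < p -> ~~ (p %| 'C(n, m)) -> ~~ (p %| 'C(n, k)).
Proof.
move=> le_km le_mn lt_mp; apply: contra => p_dvd.
have: p %| 'C(n, m) * 'C(m, k).
  by rewrite -mul_bin_trinomial ?le_km // dvdn_mull.
rewrite Euclid_dvdM // => /orP[//|/(dvdn_mulr (k`! * (m - k)`!))].
by rewrite bin_fact // => /prime_dvd_fact; rewrite leqNgt lt_mp.
Qed.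

End Binomials.

(** * The Borel action on normalised jets *)

Section Borel.
Local Open Scope ring_scope.
Variables (F : finFieldType) (p f : nat).
Hypotheses (p_prime : prime p) (cardF : #|F| = (p ^ f)%N).
Local Notation poly := {mpoly F[f + f]}.
Implicit Types (P Q : poly) (m r : 'I_f -> nat) (g b : {'GL_2[F]}).

Definition binprod r (k : 'I_f -> nat) : F := \prod_(i < f) 'C(r i, k i)%:R.

Definition njet r P (k : 'I_f -> nat) : F := P@_(mexp r k) / binprod r k.

Definition weight r : nat := \sum_(i < f) r i * p ^ i.

(** The part of the action of b on normalised jets that involves neither r nor
    the first diagonal entry of b. *)
Definition bmat b (k j : 'I_f -> nat) : F := \prod_(i < f)
  if (k i <= j i)%N
  then 'C(j i, k i)%:R * (GLval b 1 0 ^+ (p ^ i)) ^+ (j i - k i)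
       * (GLval b 1 1 ^+ (p ^ i)) ^+ k i
  else 0.

Lemma njet_linear r (k : 'I_f -> nat) a P Q :
  njet r (a *: P + Q) k = a * njet r P k + njet r Q k.
Proof. by rewrite /njet mcoeffD mcoeffZ mulrDl mulrA. Qed.

Lemma njetB r (k : 'I_f -> nat) P Q : njet r (P - Q) k = njet r P k - njet r Q k.
Proof. by rewrite /njet mcoeffB mulrBl. Qed.

Lemma njet_sum r (k : 'I_f -> nat) (I : finType) (c : I -> F) (P : I -> poly) :
  njet r (\sum_x c x *: P x) k = \sum_x c x * njet r (P x) k.
Proof.
rewrite /njet raddf_sum mulr_suml /=.
by apply: eq_bigr => x _; rewrite mcoeffZ mulrA.
Qed.

Lemma njet_local m r P (k : box m) : P \in local_ideal m -> njet r P k = 0.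
Proof.
move=> /local_idealP LP; rewrite /njet LP ?mul0r // => i.
by rewrite mexpY box_le.
Qed.

Lemma binprod_neq0 m r : (forall i, m i <= r i)%N -> (forall i, m i < p)%N ->
  ~~ (p %| \prod_(i < f) 'C(r i, m i))%N -> forall k : box m, binprod r k != 0.
Proof.
move=> le_mr lt_mp ndvd k; apply/prodf_neq0 => i _.
rewrite -(dvdn_pcharf (pcharF p_prime cardF)).
apply: (@prime_ndvd_bin_le p p_prime _ (m i)) => //; first exact: box_le.
by apply: contra ndvd => p_dvd; rewrite (bigD1 i) //= dvdn_mulr.
Qed.

Lemma borel_diag_neq0 b : GLval b 0 1 = 0 :> F -> GLval b 0 0 != 0 :> F.
Proof.
move=> b01; have := GL_det b; apply: contraNneq => b00.
rewrite (expand_det_row _ 0) big_ord_recl big_ord1 b00.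
have -> : lift ord0 ord0 = 1 :> 'I_2 by apply: val_inj.
by rewrite b01 !mul0r addr0.
Qed.

(** The identity C(r-k, j-k) C(r, k) = C(r, j) C(j, k) moves the dependence on r
    of the matrix of b into the normalising factors and a power of b_00. *)
Lemma mcoeff_mexp_borel b r (k j : 'I_f -> nat) :
    GLval b 0 1 = 0 :> F -> (forall i, k i <= r i)%N -> (forall i, j i <= r i)%N ->
  (gl_act p b 'X_[mexp r k])@_(mexp r j) * binprod r k =
  GLval b 0 0 ^+ weight r / GLval b 0 0 ^+ weight j * bmat b k j * binprod r j.
Proof.
move=> b01 le_kr le_jr; rewrite mcoeff_borel //.
have a_neq0 := borel_diag_neq0 b01.
have -> : GLval b 0 0 ^+ weight r / GLval b 0 0 ^+ weight j =
          \prod_(i < f) (GLval b 0 0 ^+ (p ^ i)) ^+ (r i - j i).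
  apply: (mulIf (expf_neq0 (weight j) a_neq0)); rewrite divfK ?expf_neq0 //.
  rewrite /weight !expr_sum -big_split /=; apply: eq_bigr => i _.
  by rewrite -exprM -exprD (mulnC (p ^ i)%N) -mulnDl subnK.
rewrite /binprod /bmat -!big_split /=; apply: eq_bigr => i _; rewrite /bcoef.
case: leqP => [le_kj|_]; last by rewrite mulr0 !mul0r.
have e : 'C(r i - k i, j i - k i)%:R * 'C(r i, k i)%:R =
         'C(r i, j i)%:R * 'C(j i, k i)%:R :> F.
  by rewrite -!natrM mul_bin_trinomial // le_kj le_jr.
by ring: e.
Qed.

Lemma gl_actB g P Q : gl_act p g (P - Q) = gl_act p g P - gl_act p g Q.
Proof. exact: (linearB (gl_act p g)). Qed.

Lemma gl_act_sum g (I : finType) (c : I -> F) (P : I -> poly) :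
  gl_act p g (\sum_x c x *: P x) = \sum_x c x *: gl_act p g (P x).
Proof.
by rewrite (linear_sum (gl_act p g)); apply: eq_bigr => x _; exact: linearZ.
Qed.

(** Apart from the normalisation, r enters only through b_00^(weight r), hence
    only through the class of weight r modulo q - 1. *)
Lemma njet_borel b m r P (j : box m) : GLval b 0 1 = 0 :> F ->
    (forall i, m i <= r i)%N -> (forall k : box m, binprod r k != 0) ->
    P \in multihomog r ->
  njet r (gl_act p b P) j = \sum_(k : box m)
    GLval b 0 0 ^+ weight r / GLval b 0 0 ^+ weight j * bmat b k j * njet r P k.
Proof.
move=> b01 le_mr bin_neq0 rP.
have le_r (k : box m) i : (k i <= r i)%N := leq_trans (box_le k i) (le_mr i).
have := njet_local r j (local_ideal_act b01 p_prime (jet_expansion le_mr rP)).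
rewrite gl_actB gl_act_sum njetB => /subr0_eq ->.
rewrite njet_sum; apply: eq_bigr => k _.
rewrite /njet -[_@_(mexp r j)](mulfK (bin_neq0 k)) mcoeff_mexp_borel //.
rewrite !mulrA [LHS]mulrAC mulfK //; congr (_ / _).
by rewrite [RHS]mulrC !mulrA.
Qed.

End Borel.

(** * The rational points of the projective line *)

Section Transversal.
Local Open Scope ring_scope.
Variable F : finFieldType.

Lemma ord2_cases (i : 'I_2) : i = 0 \/ i = 1.
Proof. by case: i => [[|[|//]] ?]; [left | right]; apply: val_inj. Qed.

Lemma GL2_mul01 (g h : {'GL_2[F]}) :
  GLval (g * h)%g 0 1 = GLval g 0 0 * GLval h 0 1 + GLval g 0 1 * GLval h 1 1 :> F.
Proof.
rewrite GL_MxE mxE big_ord_recl big_ord1.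
by congr (_ + GLval g _ _ * GLval h _ _); apply: val_inj.
Qed.

(** The cosets B g are the points [g_00 : g_01] of P^1(F_q): None stands for
    [1 : 0], represented by the identity, and Some c for [c : 1], represented by
    the matrix with rows (c, 1) and (1, 0). *)
Lemma borel_transversal : exists t : option F -> {'GL_2[F]},
  (forall g, exists x, GLval (g * (t x)^-1)%g 0 1 = 0 :> F) /\
  (forall x y, x != y -> GLval (t y * (t x)^-1)%g 0 1 != 0 :> F).
Proof.
pose M c : 'M[F]_2 := \matrix_(i, j)
  if i == 0 then if j == 0 then c else 1 else if j == 0 then 1 else 0.
pose M' c : 'M[F]_2 := \matrix_(i, j)
  if i == 0 then if j == 0 then 0 else 1 else if j == 0 then 1 else - c.
have MM' c : M c *m M' c = 1%:M.
  apply/matrixP => i j; rewrite mxE big_ord_recl big_ord1 !mxE.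
  by case: (ord2_cases i) => ->; case: (ord2_cases j) => ->;
    rewrite /= ?mulr0 ?mulr1 ?mul0r ?mul1r ?add0r ?addr0 ?subrr.
have [unitM unitM'] : (forall c, M c \is a GRing.unit) /\
    (forall c, M' c \is a GRing.unit).
  by split=> c; have [] := mulmx1_unit (MM' c).
pose w c : {'GL_2[F]} := FinRing.Unit (unitM c).
pose w' c : {'GL_2[F]} := FinRing.Unit (unitM' c).
have wV c : (w c)^-1%g = w' c.
  apply: (mulgI (w c)); rewrite mulgV; apply: val_inj.
  by transitivity (M c *m M' c); [rewrite MM' | exact: esym (GL_MxE (w c) (w' c))].
pose t x := if x is Some c then w c else 1%g.
have tV x : (t x)^-1%g = if x is Some c then w' c else 1%g.
  by case: x => [c|]; rewrite ?invg1 -?wV.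
exists t; split=> [g|x y].
  have [g01|g01] := eqVneq (GLval g 0 1 : F) 0.
    by exists None; rewrite tV mulg1.
  (* The point [g_00 : g_01] is [c : 1]. *)
  exists (Some (GLval g 0 0 / GLval g 0 1)).
  by rewrite tV GL2_mul01 !mxE /= mulr1 mulrN mulrC divfK // subrr.
rewrite tV GL2_mul01.
case: x y => [c|] [c'|] // neq_xy; rewrite ?GL_1E !mxE /=.
- rewrite mulr1 mul1r subr_eq0 eq_sym; apply: contraNneq neq_xy => ->.
  by rewrite eqxx.
- by rewrite mul1r mul0r addr0 oner_eq0.
- by rewrite mulr0 mulr1 add0r oner_eq0.
Qed.

End Transversal.

(** * Prescribing jets at the rational points *)

Section Surjectivity.
Local Open Scope ring_scope.
Variables (F : finFieldType) (p f : nat).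
Hypotheses (p_prime : prime p) (cardF : #|F| = (p ^ f)%N).
Local Notation poly := {mpoly F[f + f]}.
Local Notation q := (p ^ f)%N.
Implicit Types (P Q : poly) (m r : 'I_f -> nat) (g : {'GL_2[F]}).

(** The product of the linear forms X_i - c Y_i, for c in F_q: it vanishes at all
    the rational points except the origin Y_i = 0. *)
Definition puncture (i : 'I_f) : poly :=
  varX F i ^+ q - varX F i * varY F i ^+ q.-1.

Lemma expr_card_pE (a : F) : a ^+ q = a.
Proof. by rewrite -cardF expf_card. Qed.

Lemma pnat_pchar n : [pchar poly].-nat (p ^ n)%N.
Proof. by rewrite pnatX pnatE // (Defs.pchar_poly p_prime cardF). Qed.

Lemma q_gt0 : (0 < q)%N. Proof. by rewrite expn_gt0 prime_gt0. Qed.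

(** If g moves the origin, write g.X_i = c v + e Y_i with v = g.Y_i and c in F_q.
    As c^q = c, the terms in v^q cancel and Y_i factors out. *)
Lemma puncture_act g i : GLval g 0 1 != 0 :> F ->
  exists H, gl_act p g (puncture i) = varY F i * H.
Proof.
move=> b_neq0; rewrite /puncture rmorphB rmorphM !rmorphXn /= gl_actX gl_actY.
set a := _ ^+ (p ^ i); set c := _ ^+ (p ^ i); set b := _ ^+ (p ^ i).
set d := _ ^+ (p ^ i).
have {}b_neq0 : b != 0 by rewrite expf_neq0.
set v := b *: varX F i + _; set y := varY F i.
(* With v = b X_i + d Y_i, the form a X_i + c Y_i is (a / b) v + e Y_i. *)
pose e := c - a / b * d.
have -> : a *: varX F i + c *: y = (a / b) *: v + e *: y.
  rewrite /v /e scalerDr !scalerA divfK // -addrA; congr (_ + _).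
  by rewrite -scalerDl addrC subrK.
exists (e *: (y ^+ q.-1 - v ^+ q.-1)).
rewrite exprDn_pchar ?pnat_pchar // !exprZn !expr_card_pE mulrDl.
rewrite -!scalerAl -!exprS !prednK ?q_gt0 // opprD addrACA subrr add0r -scalerBr.
by rewrite -scalerAr; congr (_ *: _); rewrite mulrBr -exprS prednK ?q_gt0.
Qed.

Lemma local_ideal_subXX m n P Q :
  P - Q \in local_ideal m -> P ^+ n - Q ^+ n \in local_ideal m.
Proof. by move=> PQ; rewrite subrXX mulrC local_idealM. Qed.

(** Either m_i + 1 <= q - 1, and already Y_i^(q-1) is in the ideal; or m_i + 1 = p = q
    and the power is a Frobenius. *)
Lemma puncture_expr m i : (m i < p)%N ->
  puncture i ^+ (m i).+1 - varX F i ^+ (q * (m i).+1) \in local_ideal m.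
Proof.
move=> lt_mp; have f_gt0 : (0 < f)%N by apply: leq_ltn_trans (ltn_ord i).
have le_pq : (p <= q)%N.
  by rewrite -[leqLHS]expn1 leq_exp2l ?prime_gt1.
have q_gt1 : (1 < q)%N := leq_trans (prime_gt1 p_prime) le_pq.
rewrite exprM; case: (ltnP (m i) q.-1) => [lt_mq|le_qm].
  apply: local_ideal_subXX; rewrite /puncture addrC addKr.
  rewrite rpredN local_idealM // local_ideal_varY //.
(* Here q - 1 <= m_i < p <= q. *)
have -> : (m i).+1 = p by lia.
rewrite /puncture (frobpD p_prime cardF) addrC addKr -mulN1r !exprMn.
do 2 apply: local_idealM; rewrite -exprM; apply: local_ideal_varY.
by apply: leq_trans lt_mp _; rewrite leq_pmull // -subn1 subn_gt0.
Qed.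

Definition puncture_prod m : poly := \prod_(i < f) puncture i ^+ (m i).+1.

Lemma puncture_prod_jet m : (forall i, m i < p)%N ->
  puncture_prod m - 'X_[mexp (fun i => q * (m i).+1)%N (fun=> 0%N)]
    \in local_ideal m.
Proof.
move=> lt_mp; have -> : 'X_[mexp (fun i => q * (m i).+1)%N (fun=> 0%N)] =
    \prod_(i < f) varX F i ^+ (q * (m i).+1) :> poly.
  rewrite mpolyXE_id big_split_ord /= [X in _ * X]big1 ?mulr1 => [|i _].
    by apply: eq_bigr => i _; rewrite mexpX subn0.
  by rewrite mexpY expr0.
apply: (big_ind2 (fun P Q => P - Q \in local_ideal m)) => [|P P' Q Q' PP QQ|i _].
- by rewrite subrr rpred0.
- have -> : P * Q - P' * Q' = Q * (P - P') + P' * (Q - Q') by ring.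
  by rewrite rpredD ?local_idealM.
- exact: puncture_expr.
Qed.

Lemma puncture_prod_act m g : (0 < f)%N -> GLval g 0 1 != 0 :> F ->
  gl_act p g (puncture_prod m) \in local_ideal m.
Proof.
move=> f_gt0 g01; pose i := Ordinal f_gt0.
rewrite /puncture_prod (bigD1 i) //= rmorphM rmorphXn /= mulrC.
apply: local_idealM; have [H ->] := puncture_act i g01.
by rewrite exprMn mulrC; apply: local_idealM; apply: local_ideal_varY.
Qed.

Lemma multihomog_mon (n k : 'I_f -> nat) :
  (forall i, k i <= n i)%N -> ('X_[mexp n k] : poly) \in multihomog n.
Proof.
move=> le_kn; apply/multihomogP => mu; rewrite msuppX inE => /eqP -> i.
by rewrite mexpX mexpY subnK.
Qed.

Lemma multihomog_ext r s P : r =1 s -> (P \in multihomog r) = (P \in multihomog s).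
Proof. by move=> /funext ->. Qed.

Lemma puncture_prod_homog m :
  puncture_prod m \in multihomog (fun i => q * (m i).+1)%N.
Proof.
have D_homog i : puncture i \in multihomog (fun i' => (q * (i == i')))%N.
  have [xX yY] := multihomog_var F i; rewrite rpredB ?multihomog_exp //.
  rewrite (multihomog_ext (s := fun i' => ((i == i') + q.-1 * (i == i'))%N)).
    by rewrite multihomogM // multihomog_exp.
  by move=> i'; rewrite -mulSn prednK ?q_gt0.
rewrite (multihomog_ext
  (s := fun i => (\sum_(j < f) (m j).+1 * (q * (j == i)))%N)).
  by apply: multihomog_prod => j; apply: multihomog_exp.
move=> i; rewrite (bigD1 i) //= eqxx muln1 mulnC big1 ?addn0 // => j /negPf ->.
by rewrite !muln0.
Qed.

(** Multiplying the wanted jet, written in multidegree r - q (m + 1), by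
    [puncture_prod] restores multidegree r, keeps the jet at the origin and
    kills the jets at the other points. *)
Lemma jet_at_point m r (tau : box m -> F) : (0 < f)%N ->
    (forall i, m i < p)%N -> (forall i, q * (m i).+1 + m i <= r i)%N ->
    (forall k : box m, binprod F r k != 0) ->
  exists w, [/\ w \in multihomog r, forall k : box m, njet r w k = tau k &
    forall g, GLval g 0 1 != 0 :> F -> gl_act p g w \in local_ideal m].
Proof.
move=> f_gt0 lt_mp le_r bin_neq0.
pose N i := (q * (m i).+1)%N; pose n i := (r i - N i)%N.
have le_N i : (N i <= r i)%N := leq_trans (leq_addr _ _) (le_r i).
have le_n (k : box m) i : (k i <= n i)%N.
  apply: leq_trans (box_le k i) _; rewrite leq_subRL ?le_N //; exact: le_r.
pose c (k : box m) := tau k * binprod F r k.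
pose S : poly := \sum_(k : box m) c k *: 'X_[mexp n k].
exists (puncture_prod m * S); split=> [|k|g g01].
- rewrite (multihomog_ext (s := fun i => (N i + n i)%N)).
    rewrite multihomogM ?puncture_prod_homog // rpred_sum // => k _.
    by rewrite rpredZ // multihomog_mon.
  by move=> i; rewrite subnKC.
- have : (puncture_prod m - 'X_[mexp N (fun=> 0%N)]) * S \in local_ideal m.
    by rewrite mulrC local_idealM // puncture_prod_jet.
  move/(njet_local r k); rewrite mulrBl njetB => /subr0_eq ->.
  rewrite mulr_sumr (eq_bigr (fun k => c k *: 'X_[mexp r k])) => [|l _].
    rewrite njet_sum (bigD1 k) //= big1 ?addr0 => [|l neq_lk].
      by rewrite /njet /c mcoeffX eqxx mul1r mulfK.
    rewrite /njet mcoeffX; case: eqP => [eq_lk|]; last by rewrite mul0r mulr0.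
    case/eqP: neq_lk; apply: boxP => i.
    by rewrite -(mexpY r l) eq_lk mexpY.
  rewrite -scalerAr -mpolyXD; congr (_ *: 'X_[_]).
  apply: mnm_split => i; rewrite mnmDE ?mexpX ?mexpY //.
  by rewrite subn0 addnBA // subnKC.
- by rewrite rmorphM mulrC local_idealM // puncture_prod_act.
Qed.

(** Add up the translates of the polynomials of [jet_at_point], one for each
    point. *)
Lemma jets_surjective m r (t : option F -> {'GL_2[F]})
    (tau : option F -> box m -> F) : (0 < f)%N ->
    (forall x y, x != y -> GLval (t y * (t x)^-1)%g 0 1 != 0 :> F) ->
    (forall i, m i < p)%N -> (forall i, q * (m i).+1 + m i <= r i)%N ->
    (forall k : box m, binprod F r k != 0) ->
  exists2 v, v \in multihomog r &
    forall x (k : box m), njet r (gl_act p (t x) v) k = tau x k.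
Proof.
move=> f_gt0 t_sep lt_mp le_r bin_neq0.
have /choice[w wP] x := jet_at_point (tau x) f_gt0 lt_mp le_r bin_neq0.
exists (\sum_x gl_act p (t x)^-1%g (w x)) => [|y k].
  apply: rpred_sum => x _; case: (wP x) => homog_w _ _.
  exact: (multihomog_act p_prime cardF (t x)^-1%g homog_w).
have -> : gl_act p (t y) (\sum_x gl_act p (t x)^-1%g (w x)) =
    \sum_x 1 *: gl_act p (t y * (t x)^-1)%g (w x).
  rewrite (raddf_sum (gl_act p (t y))); apply: eq_bigr => x _.
  by rewrite scale1r (gl_actM p_prime cardF).
rewrite njet_sum (bigD1 y) //= mulgV (gl_act1 p_prime) mul1r.
case: (wP y) => _ -> _; rewrite big1 ?addr0 // => x neq_xy.
by case: (wP x) => _ _ L; rewrite mul1r (njet_local r k (L _ (t_sep _ _ neq_xy))).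
Qed.

End Surjectivity.

(** * Rewriting modulo the powers of the twisted Dickson polynomials *)

Section Spanning.
Local Open Scope ring_scope.
Variables (F : finFieldType) (p f : nat).
Hypotheses (p_prime : prime p) (cardF : #|F| = (p ^ f)%N).
Local Notation poly := {mpoly F[f + f]}.
Local Notation q := (p ^ f)%N.
Implicit Types (P Q : poly) (m r : 'I_f -> nat) (g : {'GL_2[F]}).

HB.instance Definition _ m := GRing.isSubmodClosed.Build F poly
  (in_theta_ideal p m) (theta_ideal_submod F p m).

Lemma theta_pow_mem m (i : 'I_f) Q :
  Q * theta F p i ^+ (m i).+1 \in in_theta_ideal p m.
Proof.
rewrite inE; apply/asboolP; exists (fun j => if j == i then Q else 0).
rewrite (bigD1 i) //= eqxx big1 ?addr0 // => j /negPf ->.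
by rewrite mul0r.
Qed.

(** Of the two terms of theta_i, the first is divisible by Y_(i-1)^p and so lies
    in the local ideal, because m_(i-1) < p; the second is divisible by Y_i. *)
Lemma theta_ideal_local m P : (forall i, m i < p)%N ->
  P \in in_theta_ideal p m -> P \in local_ideal m.
Proof.
move=> lt_mp; rewrite inE => /asboolP[h ->]; apply: rpred_sum => i _.
apply: local_idealM; rewrite /theta.
set A := varX F i * _; set C := varY F i * _.
have AL : A \in local_ideal m.
  by apply: local_idealM; apply: local_ideal_varY.
rewrite -[_ ^+ _](subrK ((- C) ^+ (m i).+1)) rpredD //.
  by apply: local_ideal_subXX; rewrite opprK subrK.
rewrite -mulN1r exprMn local_idealM // exprMn mulrC local_idealM //.
exact: local_ideal_varY.
Qed.

(** The two monomials X_i Y_(i-1)^p and Y_i X_(i-1)^p of theta_i.  The first has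
    Y-degree p and the second Y-degree 1, so replacing the leading one by the
    other decreases the Y-degree. *)
Definition theta_lead (i : 'I_f) : 'X_{1..f + f} :=
  (U_(lshift f i) + U_(rshift f (ord_pred i)) *+ p)%MM.
Definition theta_tail (i : 'I_f) : 'X_{1..f + f} :=
  (U_(rshift f i) + U_(lshift f (ord_pred i)) *+ p)%MM.

Lemma theta_monE i : theta F p i = 'X_[theta_lead i] - 'X_[theta_tail i].
Proof. by rewrite !mpolyXD -!mpolyXn. Qed.

Definition bideg (mu : 'X_{1..f + f}) (i : 'I_f) : nat :=
  (mu (lshift f i) + mu (rshift f i))%N.

Definition ydeg (mu : 'X_{1..f + f}) : nat := (\sum_(i < f) mu (rshift f i))%N.

Lemma bidegD mu nu i : bideg (mu + nu) i = (bideg mu i + bideg nu i)%N.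
Proof. by rewrite /bideg !mnmDE addnACA. Qed.

Lemma bidegMn mu n i : bideg (mu *+ n) i = (bideg mu i * n)%N.
Proof. by rewrite /bideg !mulmnE mulnDl. Qed.

Lemma ydegD mu nu : ydeg (mu + nu)%MM = (ydeg mu + ydeg nu)%N.
Proof. by rewrite /ydeg -big_split; apply: eq_bigr => i _; rewrite mnmDE. Qed.

Lemma ydegMn mu n : ydeg (mu *+ n)%MM = (ydeg mu * n)%N.
Proof. by rewrite /ydeg big_distrl; apply: eq_bigr => i _; rewrite mulmnE. Qed.

Lemma bideg_theta i : bideg (theta_lead i) =1 bideg (theta_tail i).
Proof.
move=> j; rewrite /bideg !mnmDE !mulmnE !mnm1E !eq_lrshift !eq_rlshift.
rewrite !(inj_eq (@lshift_inj _ _)) !(inj_eq (@rshift_inj _ _)).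
by rewrite mul0n !addn0 !add0n addnC.
Qed.

Lemma ydeg_lead i : ydeg (theta_lead i) = p.
Proof.
rewrite ydegD ydegMn /ydeg big1 => [|j _]; last by rewrite mnm1E eq_lrshift.
rewrite (bigD1 (ord_pred i)) //= mnm1E eqxx big1 ?addn0 ?mul1n // => j neq.
by rewrite mnm1E (inj_eq (@rshift_inj _ _)) eq_sym (negPf neq).
Qed.

Lemma ydeg_tail i : ydeg (theta_tail i) = 1.
Proof.
rewrite ydegD ydegMn /ydeg [X in (_ + X * _)%N]big1 => [|j _].
  rewrite (bigD1 i) //= mnm1E eqxx big1 ?mul0n ?addn0 // => j neq.
  by rewrite mnm1E (inj_eq (@rshift_inj _ _)) eq_sym (negPf neq).
by rewrite mnm1E eq_lrshift.
Qed.

Lemma theta_powE i n : theta F p i ^+ n = 'X_[theta_lead i *+ n] +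
  \sum_(k < n) ((-1) ^+ k.+1 * 'C(n, k.+1)%:R) *:
     'X_[theta_lead i *+ (n - k.+1) + theta_tail i *+ k.+1].
Proof.
rewrite theta_monE -scaleN1r exprDn big_ord_recl /= subn0 expr0 mulr1 bin0.
rewrite mulr1n mpolyXn; congr (_ + _); apply: eq_bigr => k _.
rewrite /bump /= add1n exprZn !mpolyXn -scalerAr -mpolyXD -scaler_nat scalerA.
by rewrite mulrC.
Qed.

(** No leading monomial (X_i Y_(i-1)^p)^(m_i+1) divides the monomial of Y-exponents
    b in multidegree r. *)
Definition irreducible_exp m r (b : box r) : bool :=
  [forall i, (r i - b i <= m i)%N || (b (ord_pred i) < p * (m i).+1)%N].

Definition spanned m r P : Prop := exists2 c : {ffun box r -> F},
  (forall b, ~~ irreducible_exp m b -> c b = 0) &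
  P - \sum_(b : box r) c b *: 'X_[mexp r b] \in in_theta_ideal p m.

Lemma spanned_linear m r a P Q :
  spanned m r P -> spanned m r Q -> spanned m r (a *: P + Q).
Proof.
move=> [c c0 cP] [d d0 dQ]; exists [ffun b => a * c b + d b].
  by move=> b b_red; rewrite ffunE c0 // d0 // mulr0 addr0.
under eq_bigr => b _ do rewrite ffunE scalerDl -scalerA.
rewrite big_split /= -scaler_sumr opprD addrACA -scalerBr.
by apply: rpredD => //; apply: rpredZ.
Qed.

Lemma spanned_ideal m r P : P \in in_theta_ideal p m -> spanned m r P.
Proof.
move=> P_in; exists [ffun=> 0] => [b _|]; first by rewrite ffunE.
by rewrite big1 ?subr0 // => b _; rewrite ffunE scale0r.
Qed.

Lemma spanned_sum m r (I : Type) (s : seq I) (c : I -> F) (Q : I -> poly) :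
  (forall x, spanned m r (Q x)) -> spanned m r (\sum_(x <- s) c x *: Q x).
Proof.
move=> spQ; elim: s => [|x s IHs].
  by rewrite big_nil; apply/spanned_ideal/rpred0.
by rewrite big_cons; apply: spanned_linear.
Qed.

(** Induction on the Y-degree: a reducible monomial is a multiple of some
    theta_i^(m_i+1) plus monomials of the same multidegree and smaller
    Y-degree. *)
Lemma mon_spanned m r (mu : 'X_{1..f + f}) :
  bideg mu =1 r -> spanned m r 'X_[mu].
Proof.
have [N] := ubnP (ydeg mu); elim: N mu => // N IHN mu /ltnSE le_N mu_r.
have le_r i : (mu (rshift f i) <= r i)%N by rewrite -mu_r leq_addl.
pose b := to_box r (fun i => mu (rshift f i)).
have bE i : b i = mu (rshift f i) by rewrite to_boxE.
have muE : mu = mexp r b.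
  by apply: mnm_split => i; rewrite ?mexpX ?mexpY bE // -mu_r addnK.
case irr_b: (irreducible_exp m b).
  exists [ffun b' => (b' == b)%:R].
    by move=> b'; rewrite ffunE; case: eqP => // ->; rewrite irr_b.
  rewrite (bigD1 b) //= ffunE eqxx scale1r big1 ?addr0 => [|b' /negPf neq].
    by rewrite muE subrr rpred0.
  by rewrite ffunE neq scale0r.
move/negbT: irr_b; rewrite negb_forall => /existsP[i].
rewrite negb_or -ltnNge -leqNgt => /andP[lt_mX le_pY].
have le_mu : (theta_lead i *+ (m i).+1 <= mu)%MM.
  apply/mnm_lepP => x; rewrite muE mulmnE mnmDE mulmnE !mnm1E.
  case: (split_ordP x) => j ->.
    rewrite eq_rlshift (inj_eq (@lshift_inj _ _)) mexpX.
    by case: eqP => [<-|_]; rewrite ?addn0 ?mul1n.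
  rewrite eq_lrshift (inj_eq (@rshift_inj _ _)) mexpY.
  by case: eqP => [<-|_]; rewrite ?add0n ?mul1n.
pose nu := (mu - theta_lead i *+ (m i).+1)%MM.
have mu_nu : mu = (nu + theta_lead i *+ (m i).+1)%MM by rewrite submK.
have := theta_pow_mem m i 'X_[nu]; move/(spanned_ideal r).
rewrite theta_powE mulrDr -mpolyXD -mu_nu => sp.
rewrite -[X in spanned _ _ X](addrK (\sum_(k < (m i).+1)
   ((-1) ^+ k.+1 * 'C((m i).+1, k.+1)%:R) *: ('X_[nu] *
     'X_[theta_lead i *+ ((m i).+1 - k.+1) + theta_tail i *+ k.+1]))).
rewrite addrC -scaleN1r; apply: spanned_linear; last first.
  by move: sp; rewrite mulr_sumr; under eq_bigr do rewrite -scalerAr.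
apply: spanned_sum => k; rewrite -mpolyXD; apply: IHN => [|j].
  apply: leq_trans le_N; rewrite mu_nu 3!ydegD !ydegMn ydeg_lead ydeg_tail.
  rewrite ltn_add2l mul1n -ltn_subRL -mulnBr subKn ?ltn_ord //.
  by rewrite -{1}[k.+1]mul1n ltn_pmul2r ?prime_gt1.
by rewrite -mu_r mu_nu 3!bidegD !bidegMn -bideg_theta -mulnDr subnK.
Qed.

Lemma homog_spanned m r P : P \in multihomog r -> spanned m r P.
Proof.
move=> /multihomogP rP; rewrite [P]mpolyE big_seq_cond.
elim/big_rec: _ => [|mu Q]; first exact/spanned_ideal/rpred0.
by rewrite andbT => /rP mu_r spQ; apply: spanned_linear => //; apply: mon_spanned.
Qed.

End Spanning.

(** * Counting the irreducible monomials *)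

Section Counting.
Variables (p f : nat).
Hypothesis p_prime : prime p.
Implicit Types m r : 'I_f -> nat.

Lemma ordS_ind (A : 'I_f -> Prop) (i : 'I_f) :
  A i -> (forall j, A j -> A (ordS j)) -> forall j, A j.
Proof.
move=> Ai AS j.
have iterE k : iter k (@ordS f) i = (i + k) %% f :> nat.
  elim: k => [|k IHk]; first by rewrite addn0 modn_small.
  by rewrite iterS /= IHk -addn1 modnDml addn1 addnS.
(* Going round once from i, then up to j. *)
have -> : j = iter (f - i + j) (@ordS f) i.
  apply: val_inj; rewrite /= iterE addnA subnKC ?modnDl ?modn_small //.
  exact: ltnW.
by elim: (f - i + j) => //= k; apply: AS.
Qed.

(** If the X-exponent of index i is at most m_i, then the Y-exponent of index i is
    at least q (m_i + 1) >= p (m_(i+1) + 1), so irreducibility at i + 1 forces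
    the X-exponent of index i + 1 to be at most m_(i+1).  Thus this happens for
    all indices or for none. *)
Lemma irreducible_exp_high_low m r (b : box r) :
    (forall i, m i < p) -> (forall i, p ^ f * (m i).+1 + m i <= r i) ->
    irreducible_exp p m b ->
  (forall i, r i - b i <= m i) \/ (forall i, b i < p * (m (ordS i)).+1).
Proof.
move=> lt_mp le_r /forallP irr_b.
case: (pickP (fun i => r i - b i <= m i)) => [i0 hi0|no_hi]; [left | right].
  apply: (ordS_ind (A := fun i => r i - b i <= m i) hi0) => i hi.
  have := irr_b (ordS i); rewrite ordSK => /orP[//|lt_b].
  suff: p * (m (ordS i)).+1 <= p ^ f * (m i).+1.
    by have := le_r i; have := box_le b i; lia.
  (* For f = 1 the two sides agree; for f >= 2 use m + 1 <= p and p^2 <= q. *)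
  case: f i m lt_mp {le_r irr_b hi0 hi lt_b b i0 r} => [|[|f']] i m lt_mp.
  - by case: i.
  - by have -> : ordS i = i by rewrite [ordS i]ord1 (ord1 i).
  apply: (@leq_trans (p ^ 2)); first by rewrite -mulnn leq_mul.
  by rewrite -[p ^ 2]muln1 leq_mul // leq_pexp2l // prime_gt0.
move=> i; have := irr_b (ordS i).
by rewrite ordSK no_hi.
Qed.

Lemma card_irreducible_exp m r :
    (forall i, m i < p) -> (forall i, p ^ f * (m i).+1 + m i <= r i) ->
  #|[set b : box r | irreducible_exp p m b]| <= (p ^ f).+1 * \prod_(i < f) (m i).+1.
Proof.
move=> lt_mp le_r.
pose H := [set b : box r | [forall i, r i - b i <= m i]].
pose n i := (p * (m (ordS i)).+1).-1.
pose L := [set b : box r | [forall i, b i <= n i]].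
have pS i : (n i).+1 = p * (m (ordS i)).+1.
  by rewrite prednK // muln_gt0 prime_gt0.
have /subset_leq_card/leq_trans : [set b : box r | irreducible_exp p m b] \subset H :|: L.
  apply/subsetP => b; rewrite !inE => /(irreducible_exp_high_low lt_mp le_r).
  by case=> h; apply/orP; [left | right]; apply/forallP => i; rewrite // -ltnS pS.
apply; apply: leq_trans (leq_card_setU _ _) _; rewrite mulSn leq_add //.
- rewrite -card_box -[leqLHS](@card_in_imset _ _
    (fun b : box r => to_box m (fun i => r i - b i))) ?max_card //.
  move=> b b'; rewrite !inE => /forallP hb /forallP hb' eq_b; apply: boxP => i.
  have := congr1 (fun k : box m => k i) eq_b; rewrite !to_boxE //.
  by have := box_le b i; have := box_le b' i; lia.
- have -> : p ^ f * \prod_(i < f) (m i).+1 = \prod_(i < f) (n i).+1.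
    under [RHS]eq_bigr => i _ do rewrite pS.
    rewrite big_split /= prod_nat_const card_ord; congr (_ * _).
    rewrite (reindex (@ordS f)) //; exists (@ord_pred f) => i _;
      [exact: ordSK | exact: ord_predK].
  rewrite -card_box -[leqLHS](@card_in_imset _ _ (fun b : box r => to_box n b))
    ?max_card //.
  move=> b b'; rewrite !inE => /forallP hb /forallP hb' eq_b; apply: boxP => i.
  by have := congr1 (fun k : box n => k i) eq_b; rewrite !to_boxE.
Qed.

End Counting.

(** * The isomorphism *)

Lemma surj_leq_card_inj (S T : finType) (h : S -> T) :
  (forall y, exists x, h x = y) -> #|S| <= #|T| -> injective h.
Proof.
move=> h_surj le_ST; apply: in2T; apply/image_injP.
rewrite eqn_leq leq_image_card (leq_trans le_ST) //.
apply/subset_leq_card/subsetP => y _; have [x <-] := h_surj y.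
exact: image_f.
Qed.

Section Isomorphism.
Local Open Scope ring_scope.
Variables (F : finFieldType) (p f : nat).
Hypotheses (p_prime : prime p) (f_gt0 : (0 < f)%N) (cardF : #|F| = (p ^ f)%N).
Local Notation poly := {mpoly F[f + f]}.
Local Notation q := (p ^ f)%N.
Implicit Types (P Q : poly) (m r : 'I_f -> nat) (g : {'GL_2[F]}).

Lemma njet_theta_ideal m r P g (k : box m) : (forall i, m i < p)%N ->
  P \in in_theta_ideal p m -> njet r (gl_act p g P) k = 0.
Proof.
move=> lt_mp P_in; apply: njet_local; apply: theta_ideal_local => //.
exact: (theta_ideal_act p_prime cardF g P_in).
Qed.

Lemma jets_injective m r P : (forall i, m i < p)%N ->
    (forall i, q * (m i).+1 + m i <= r i)%N ->
    (forall k : box m, binprod F r k != 0) -> P \in multihomog r ->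
    (forall g (k : box m), njet r (gl_act p g P) k = 0) ->
  P \in in_theta_ideal p m.
Proof.
move=> lt_mp le_r bin_neq0 rP jetP0.
(* ev sends a combination of irreducible monomials to its family of jets. *)
have [t [_ t_sep]] := borel_transversal F.
pose A := [set b : box r | irreducible_exp p m b]; pose I := {b : box r | b \in A}.
pose comb (c : {ffun I -> F}) : poly := \sum_b c b *: 'X_[mexp r (val b : box r)].
pose ev (c : {ffun I -> F}) : {ffun option F * box m -> F} :=
  [ffun xk : option F * box m => njet r (gl_act p (t xk.1) (comb c)) xk.2].
have reduce Q : Q \in multihomog r ->
    exists c, Q - comb c \in in_theta_ideal p m.
  move=> /(homog_spanned p_prime m)[c c0 Qc]; exists [ffun b : I => c (val b)].
  pose G (b : box r) : poly := c b *: 'X_[mexp r b].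
  suff -> : comb [ffun b : I => c (val b)] = \sum_b G b by [].
  rewrite [RHS](bigID (mem A)) /= [X in _ + X]big1 ?addr0 => [|b].
    rewrite (big_sub A G).
    by apply: eq_bigr => b _; rewrite ffunE.
  by rewrite inE /G => /c0 ->; rewrite scale0r.
have ev_surj tau : exists c, ev c = tau.
  have [v rv jet_v] := jets_surjective p_prime cardF
    (fun x k => tau (x, k)) f_gt0 t_sep lt_mp le_r bin_neq0.
  have [c v_c] := reduce v rv; exists c; apply/ffunP => -[x k].
  rewrite ffunE -jet_v /=; apply/esym/subr0_eq.
  by rewrite -njetB -gl_actB njet_theta_ideal.
have card_le : (#|{ffun I -> F}| <= #|{ffun option F * box m -> F}|)%N.
  rewrite !card_ffun leq_pexp2l ?cardF ?expn_gt0 ?prime_gt0 //.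
  rewrite card_prod card_option cardF card_box card_sig.
  exact: card_irreducible_exp.
have [c P_c] := reduce P rP.
suff c0 : c = [ffun=> 0].
  by move: P_c; rewrite /comb big1 ?subr0 // => b _; rewrite c0 ffunE scale0r.
apply: (surj_leq_card_inj ev_surj card_le); apply/ffunP => -[x k].
rewrite !ffunE /=; transitivity (0 : F).
  have /eqP := njet_theta_ideal r (t x) k lt_mp P_c.
  by rewrite gl_actB njetB jetP0 sub0r oppr_eq0 => /eqP.
rewrite /comb big1 => [|b _]; last by rewrite ffunE scale0r.
by rewrite rmorph0 /njet mcoeff0 mul0r.
Qed.

Lemma expr_weight_mod r (s : 'I_f -> nat) (a : F) : a != 0 ->
  weight p r = weight p s %[mod q.-1] -> a ^+ weight p r = a ^+ weight p s.
Proof.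
move=> a_neq0 eq_rs; have aq : a ^+ q.-1 = 1.
  by apply: (mulfI a_neq0); rewrite -exprS prednK ?q_gt0 // -cardF expf_card mulr1.
by rewrite -(expr_mod (weight p r) aq) eq_rs expr_mod.
Qed.

Definition same_jets m r (s : 'I_f -> nat) P Q : Prop :=
  forall g (k : box m), njet r (gl_act p g P) k = njet s (gl_act p g Q) k.

(** The jets are matched at one representative of each coset B g by surjectivity;
    [njet_borel] propagates the equality to the whole coset, since the weights
    of r and s agree modulo q - 1. *)
Lemma same_jets_exists m r (s : 'I_f -> nat) P : (forall i, m i < p)%N ->
    (forall i, q * (m i).+1 + m i <= r i)%N ->
    (forall i, q * (m i).+1 + m i <= s i)%N ->
    (forall k : box m, binprod F r k != 0) ->
    (forall k : box m, binprod F s k != 0) ->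
    weight p r = weight p s %[mod q.-1] -> P \in multihomog r ->
  exists2 Q, Q \in multihomog s & same_jets m r s P Q.
Proof.
move=> lt_mp le_r le_s bin_r bin_s eq_rs rP.
have [t [t_cover t_sep]] := borel_transversal F.
have [Q sQ jetQ] := jets_surjective p_prime cardF
  (fun x k => njet r (gl_act p (t x) P) k) f_gt0 t_sep lt_mp le_s bin_s.
exists Q => // g k; have [x b01] := t_cover g.
have le_mr i : (m i <= r i)%N := leq_trans (leq_addl _ _) (le_r i).
have le_ms i : (m i <= s i)%N := leq_trans (leq_addl _ _) (le_s i).
rewrite -[g](mulgKV (t x)) !(gl_actM p_prime cardF (g * (t x)^-1)%g).
have rPx : gl_act p (t x) P \in multihomog r.
  exact: (multihomog_act p_prime cardF (t x) rP).
have sQx : gl_act p (t x) Q \in multihomog s.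
  exact: (multihomog_act p_prime cardF (t x) sQ).
rewrite (njet_borel p_prime k b01 le_mr bin_r rPx).
rewrite (njet_borel p_prime k b01 le_ms bin_s sQx).
apply: eq_bigr => l _; rewrite jetQ; congr (_ / _ * _ * _).
exact: expr_weight_mod (borel_diag_neq0 b01) eq_rs.
Qed.

Lemma V_quot_iso m r (s : 'I_f -> nat) : (forall i, m i < p)%N ->
    (forall i, q * (m i).+1 + m i <= r i)%N ->
    (forall i, q * (m i).+1 + m i <= s i)%N ->
    (forall k : box m, binprod F r k != 0) ->
    (forall k : box m, binprod F s k != 0) ->
    weight p r = weight p s %[mod q.-1] ->
  rep_iso (V_quot p_prime cardF m r) (V_quot p_prime cardF m s).
Proof.
move=> lt_mp le_r le_s bin_r bin_s eq_rs.
pose I := theta_ideal p_prime cardF m.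
pose Vr := V_sub p_prime cardF r; pose Vs := V_sub p_prime cardF s.
apply: (@quot_rep_iso _ _ _ _ (sub_cap Vr I) (sub_cap Vs I)
  (fun u v => same_jets m r s (sub_val u) (sub_val v))).
- move=> a u u' v v' uv uv' g k.
  by rewrite /= !linearP !njet_linear uv uv'.
- by move=> h u v uv g k; rewrite /= -!(gl_actM p_prime cardF) uv.
- move=> [u ru]; have [v sv uv] := same_jets_exists lt_mp le_r le_s bin_r bin_s eq_rs ru.
  by exists (SubSpace (S := Vs) sv).
- move=> [v sv].
  have [u ru vu] := same_jets_exists lt_mp le_s le_r bin_s bin_r (esym eq_rs) sv.
  by exists (SubSpace (S := Vr) ru) => g k /=; rewrite vu.
- move=> [u ru] [v sv] /= uv; rewrite !inE /=; apply/idP/idP => in_I.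
    apply: (jets_injective lt_mp le_s bin_s sv) => g k.
    by rewrite -uv njet_theta_ideal.
  apply: (jets_injective lt_mp le_r bin_r ru) => g k.
  by rewrite uv njet_theta_ideal.
Qed.

End Isomorphism.

Theorem corollary1p4 (p f : nat) (p_prime : prime p) (f_ge1 : 1 <= f)
    (F : finFieldType) (cardF : #|F| = p ^ f)
    (m r s : nat) (m_ r_ s_ : 'I_f -> nat)
    (m_def : m = \sum_(i < f) m_ i * p ^ i)
    (m_digit : forall i, 0 <= m_ i <= p - 1)
    (r_def : r = \sum_(i < f) r_ i * p ^ i)
    (s_def : s = \sum_(i < f) s_ i * p ^ i)
    (r_ge : forall i, (m_ i + 1) * (p ^ f + 1) - 1 <= r_ i)
    (s_ge : forall i, (m_ i + 1) * (p ^ f + 1) - 1 <= s_ i)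
    (r_s : r = s %[mod p ^ f - 1])
    (r_bin : ~~ (p %| \prod_(i < f) 'C(r_ i, m_ i)))
    (s_bin : ~~ (p %| \prod_(i < f) 'C(s_ i, m_ i))) :
  rep_iso (V_quot p_prime cardF m_ r_) (V_quot p_prime cardF m_ s_).
Proof.
have lt_mp i : m_ i < p.
  by rewrite -(prednK (prime_gt0 p_prime)) ltnS -subn1; case/andP: (m_digit i).
have bound (n : 'I_f -> nat) :
    (forall i, (m_ i + 1) * (p ^ f + 1) - 1 <= n i) ->
    forall i, p ^ f * (m_ i).+1 + m_ i <= n i.
  move=> n_ge i; apply: leq_trans (n_ge i).
  rewrite !addn1 [leqRHS](_ : _ = p ^ f * (m_ i).+1 + m_ i) //.
  by rewrite mulnS addSn subn1 addnC mulnC.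
have le_m (n : 'I_f -> nat) :
    (forall i, (m_ i + 1) * (p ^ f + 1) - 1 <= n i) -> forall i, m_ i <= n i.
  by move=> n_ge i; apply: leq_trans (bound n n_ge i); apply: leq_addl.
apply: V_quot_iso => //; try exact: bound.
- exact: (binprod_neq0 p_prime cardF (le_m _ r_ge) lt_mp r_bin).
- exact: (binprod_neq0 p_prime cardF (le_m _ s_ge) lt_mp s_bin).
- by rewrite /weight -r_def -s_def -subn1.
Qed.
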